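(* Let $d=3$. For $\epsilon\in(0,1]$ let $$B_\epsilon(|q|,\xi)=|q|\,b_\epsilon(\xi),\qquad \tilde B_\epsilon(|q|,\xi)=b_\epsilon(\xi),\qquad b_\epsilon(\xi)=\frac{\xi}{\|b_\epsilon\|}\mathbf{1}_{[0,\epsilon]}(\xi),\qquad \|b_\epsilon\|=|\mathbb{S}^2|\int_0^\epsilon\xi\,d\xi=2\pi\epsilon^2 .$$ There exists a number $C>0$, independent of $\epsilon\in(0,1]$, such that $$\mathcal{D}_\Phi^{B_\epsilon}(f)\ \ge\ C\,\mathcal{D}_\Phi^{\tilde B_\epsilon}(f)$$ for any convex function $\Phi:[0,\infty)\to[0,\infty)$ and any probability distribution $f\in L^1(\mathbb{R}^3)$.
   Context: $M(v)=(2\pi\theta)^{-3/2}\exp\left(-\frac{|v-u_0|^2}{2\theta}\right)$ with $u_0\in\mathbb{R}^3$, $\theta>0$ fixed ($C$ may depend on $M$). A probability distribution is a nonnegative $f\in L^1(\mathbb{R}^3)$ with $\int f\,dv=1$. For $v,v_*\in\mathbb{R}^3$, $n\in\mathbb{S}^2$ put $q=v-v_*$, $\xi=|q\cdot n|/|q|$, $v'=v-(q\cdot n)n$. For a collision kernel $B(|q|,\xi)\ge0$ and a convex $\Phi:[0,\infty)\to[0,\infty)$, the dissipation of the relative $\Phi$-entropy $\int M\,\Phi(f/M)\,dv$ is $$\mathcal{D}_\Phi^{B}(f)=\frac12\int_{\mathbb{R}^3}\int_{\mathbb{R}^3}\int_{\mathbb{S}^2}B(|q|,\xi)M(v)M(v_*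 )\,\Psi\left(\frac{f(v)}{M(v)},\frac{f(v')}{M(v')}\right)dn\,dv\,dv_*\in[0,+\infty],$$ $$\Psi(x,y)=(x-y)(\Phi'(x)-\Phi'(y))\ge0 .$$ Here $\Phi$ is taken differentiable on $(0,\infty)$, $\Phi'(0)$ denotes the limit $\Phi'(0^+)\in[-\infty,\infty)$, and $\Psi(0,0)=0$. *)

(* Defs.v *)
From HB Require Import structures.
From mathcomp Require Import all_boot all_order all_algebra.
From mathcomp Require Import all_classical all_reals all_analysis.
From mathcomp Require Import measurable_realfun ring lra.

Set Implicit Arguments.
Unset Strict Implicit.
Unset Printing Implicit Defensive.

Import Order.TTheory GRing.Theory Num.Theory.
Import numFieldNormedType.Exports.

Local Open Scope classical_set_scope.
Local Open Scope ring_scope.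

(* The library registers no sigma-finite structure on the product [m1 \x m2] of
   two arbitrary sigma-finite measures; it is attached to this alias instead, so
   that products can be iterated and Fubini-Tonelli applied to them. *)
Section sigma_finite_product.
Context d1 d2 (T1 : measurableType d1) (T2 : measurableType d2) (R : realType)
  (m1 : {sigma_finite_measure set T1 -> \bar R})
  (m2 : {sigma_finite_measure set T2 -> \bar R}).

Definition sfprod : set (T1 * T2) -> \bar R := (m1 \x m2)%E.

HB.instance Definition _ := Measure.on sfprod.

Let sfprod_sigma_finite : sigma_finite setT sfprod.
Proof.
have /sigma_finiteP[F [TF ndF Foo]] := sigma_finiteT m1.
have /sigma_finiteP[G [TG ndG Goo]] := sigma_finiteT m2.
exists (fun n => F n `*` G n).
  rewrite -setXTT TF TG predeqE => -[x y]; split.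
    move=> [/= [n _ Fnx] [k _ Gky]]; exists (maxn n k) => //; split.
    - by move: x Fnx; exact/subsetPset/ndF/leq_maxl.
    - by move: y Gky; exact/subsetPset/ndG/leq_maxr.
  by move=> [n _ []/= ? ?]; split; exists n.
move=> k; have [? ?] := Foo k; have [? ?] := Goo k.
split; first exact: measurableX.
by rewrite /sfprod product_measure1E// lte_mul_pinfty// ge0_fin_numE.
Qed.

HB.instance Definition _ :=
  Measure_isSigmaFinite.Build _ _ _ sfprod sfprod_sigma_finite.

End sigma_finite_product.

(* R^3 carries the product sigma-algebra (the Borel sets). The library norm on
   products is the sup norm, so the Euclidean one is [norm3] below. *)
Notation R3 R :=
  (measurableTypeR R * measurableTypeR R * measurableTypeR R)%type.

Section euclidean_space.
Context {R : realType}.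
Implicit Types v w : R3 R.

Definition sub3 v w : R3 R := (v.1.1 - w.1.1, v.1.2 - w.1.2, v.2 - w.2).

Definition scale3 (a : R) v : R3 R := (a * v.1.1, a * v.1.2, a * v.2).

Definition dot3 v w : R := v.1.1 * w.1.1 + v.1.2 * w.1.2 + v.2 * w.2.

Definition norm3 v : R := Num.sqrt (dot3 v v).

Definition leb3 : {sigma_finite_measure set (R3 R) -> \bar R} :=
  sfprod (sfprod (@lebesgue_measure R) (@lebesgue_measure R))
         (@lebesgue_measure R).

(* Unit vector of polar angle [t] in [0, pi] and azimuth [p] in [0, 2 pi]. *)
Definition sphere_pt (t p : R) : R3 R :=
  (sin t * cos p, sin t * sin p, cos t).

(* Integral over S^2 against the surface measure dn = sin t dp dt. *)
Definition sphere_int (g : R3 R -> \bar R) : \bar R :=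
  (\int[lebesgue_measure]_(t in `[0%R, pi%R])
     \int[lebesgue_measure]_(p in `[0%R, (2 * pi)%R])
       ((sin t)%:E * g (sphere_pt t p)))%E.

Definition sphere_area : R := fine (sphere_int (fun=> 1%E)).

End euclidean_space.

Section dissipation.
Context {R : realType}.
Implicit Types (B : R -> R -> R) (Phi : R -> R) (f : R3 R -> R).
Implicit Types v w n : R3 R.

Definition maxwellian (u0 : R3 R) (theta : R) v : R :=
  (2 * pi * theta) `^ (- (3 / 2)) *
  expR (- (norm3 (sub3 v u0) ^+ 2 / (2 * theta))).

(* The L^1 class of a probability distribution is represented by a Borel
   function that is nonnegative everywhere. *)
Definition is_prob_distribution f : Prop :=
  [/\ forall v, 0 <= f v,
      leb3.-integrable setT (EFin \o f)
    & (\int[leb3]_v (f v)%:E = 1)%E].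

(* Phi' on [0, +oo[, with Phi'(0) = Phi'(0+), possibly -oo. *)
Definition dPhi Phi (x : R) : \bar R :=
  if x == 0 then lim ((derive1 Phi y)%:E @[y --> 0^'+])
  else (derive1 Phi x)%:E.

Definition Psi Phi (x y : R) : \bar R :=
  if (x == 0) && (y == 0) then 0%E
  else ((x - y)%:E * (dPhi Phi x - dPhi Phi y))%E.

Definition post_velocity v w n : R3 R := sub3 v (scale3 (dot3 (sub3 v w) n) n).

(* Equal to 0 by convention on the null set v = w. *)
Definition coll_xi v w n : R := `|dot3 (sub3 v w) n| / norm3 (sub3 v w).

Definition entropy_dissipation (u0 : R3 R) (theta : R) B Phi f : \bar R :=
  let M := maxwellian u0 theta in
  ((2^-1)%:E *
   \int[leb3]_v \int[leb3]_w sphere_int (fun n =>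
     (B (norm3 (sub3 v w)) (coll_xi v w n) * M v * M w)%:E *
     Psi Phi (f v / M v)
             (f (post_velocity v w n) / M (post_velocity v w n))))%E.

End dissipation.

Section kernels.
Context {R : realType}.

Definition b_norm (eps : R) : R :=
  sphere_area * \int[lebesgue_measure]_(x in `[0, eps]) x.

Definition b_eps (eps : R) (x : R) : R := x / b_norm eps * \1_(`[0, eps]) x.

Definition B_eps (eps : R) (q x : R) : R := q * b_eps eps x.

Definition Btilde_eps (eps : R) (q x : R) : R := b_eps eps x.

End kernels.

Arguments sphere_area : clear implicits.

Lemma sphere_areaE (R : realType) : sphere_area R = 4 * pi.
Proof.
have p1 := pi_gt0 R.
have inner (t : R) :
    (\int[lebesgue_measure]_(p in `[0%R, (2 * pi)%R])
       ((sin t)%:E * 1) = (2 * pi * sin t)%:E)%E.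
  rewrite mule1 integral_cst//= lebesgue_measure_itv/= lte_fin mulr_gt0//.
  by rewrite -EFinB -EFinM subr0 mulrC.
rewrite /sphere_area /sphere_int; under eq_integral do rewrite inner.
have dF (x : R) : is_derive x 1 (fun t => - (2 * pi) * cos t) (2 * pi * sin x).
  by apply: is_derive_eq; rewrite /GRing.scale/=; ring.
have cF : continuous (fun t : R => - (2 * pi) * cos t).
  move=> x; apply/differentiable_continuous/derivable1_diffP.
  exact: ex_derive.
rewrite (@continuous_FTC2 _ _ (fun t => - (2 * pi) * cos t))//.
- by rewrite -EFinB/= cos0 cospi; ring.
- apply: continuous_subspaceT => x; apply: cvgM; first exact: cvg_cst.
  exact: continuous_sin.
- split; [by move=> x _; exact: ex_derive|exact/cvg_at_right_filter/cF|].
  exact/cvg_at_left_filter/cF.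
- by move=> x _; rewrite derive1E derive_val.
Qed.

Lemma b_normE (R : realType) (eps : R) :
  0 < eps -> b_norm eps = 2 * pi * eps ^+ 2.
Proof.
move=> e0; rewrite /b_norm sphere_areaE /Rintegral.
have dF (x : R) : is_derive x 1 (fun t : R => t ^+ 2 * 2^-1) x.
  by apply: is_derive_eq; rewrite /GRing.scale/=; field.
have cF : continuous (fun t : R => t ^+ 2 * 2^-1).
  move=> x; apply/differentiable_continuous/derivable1_diffP.
  exact: ex_derive.
rewrite (@continuous_FTC2 _ _ (fun t => t ^+ 2 * 2^-1))//.
- by rewrite -EFinB/=; field.
- by apply: continuous_subspaceT => x; exact: cvg_id.
- split; [by move=> x _; exact: ex_derive|exact/cvg_at_right_filter/cF|].
  exact/cvg_at_left_filter/cF.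
- by move=> x _; rewrite derive1E derive_val.
Qed.

Lemma norm3_sphere_pt (R : realType) (t p : R) : norm3 (sphere_pt t p) = 1.
Proof.
rewrite /norm3 /dot3/=.
have -> : sin t * cos p * (sin t * cos p) + sin t * sin p * (sin t * sin p) +
    cos t * cos t = cos t ^+ 2 + sin t ^+ 2 * (cos p ^+ 2 + sin p ^+ 2) :> R.
  by ring.
by rewrite cos2Dsin2 mulr1 cos2Dsin2 sqrtr1.
Qed.

(* Main.v *)
Require Import Defs.
From mathcomp Require Import all_boot all_order all_algebra.
From mathcomp Require Import all_classical all_reals all_analysis.
From mathcomp Require Import unstable measurable_realfun ring lra.
Import Order.TTheory GRing.Theory Num.Theory.
Import numFieldNormedType.Exports.
Set Implicit Arguments.
Unset Strict Implicit.
Unset Printing Implicit Defensive.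
Local Open Scope classical_set_scope.
Local Open Scope ring_scope.

(** Fix [v] and the unit vector [n], and put [q = v - w]. The integrand for
    [B_eps] is [G = |q| Gt], where [Gt] is the one for [Btilde_eps], so only the
    singularity [1 / |q|] for [|q| < 1] matters, and by Tonelli it is enough to
    compare the integrals over [w]. Translating [w] in a direction orthogonal
    to [n] changes neither [q . n] nor [v'], and lets [G] decrease at most by the
    factor [K = exp (9 / (2 theta))] as long as the translation makes [|q|] larger
    and brings [w] towards the centre of the Maxwellian. Averaging over such
    translations along two orthonormal directions replaces the singular weight,
    which is dominated by [k (q . e1) k (q . e2)] with [k s ~ |s|^(-1/2)], by the
    squared integral of [k]. This yields the constant [1 + 64 K^2], whatever
    [eps], [Phi] and [f]. *)

(** * Tonelli's theorem with one variable confined to a measurable set *)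

Section tonelli_restricted.
Local Open Scope ereal_scope.
Context d1 d2 (X : measurableType d1) (Y : measurableType d2) (R : realType).
Variables (m1 : {sigma_finite_measure set X -> \bar R})
          (m2 : {sigma_finite_measure set Y -> \bar R}).
Variables (D : set Y) (F : X * Y -> \bar R).
Hypotheses (mD : measurable D) (mF : measurable_fun setT F)
  (F0 : forall x y, D y -> 0 <= F (x, y)).

(** Extension by zero outside [D] turns integrals over [D] into integrals over the whole space, and
    asks for the sign of [F] on [D] only. *)
Let G := F \_ (setT `*` D).

Let mG : measurable_fun setT G.
Proof.
apply/(measurable_restrictT _ _).1; first exact: measurableX.
exact: measurable_funTS.
Qed.

Let G0 z : 0 <= G z.
Proof. by case: z => x y; apply: erestrict_ge0 => -[? ?] [_]; exact: F0. Qed.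

Let GE x y : G (x, y) = ((fun y => F (x, y)) \_ D) y.
Proof.
rewrite /G !patchE; congr (if _ then _ else _).
by apply/idP/idP; rewrite !inE => // -[].
Qed.

Let integral_G x : \int[m2]_y G (x, y) = \int[m2]_(y in D) F (x, y).
Proof. by rewrite [RHS]integral_mkcond; apply: eq_integral => y _; rewrite GE. Qed.

Lemma measurable_integral_in :
  measurable_fun setT (fun x => \int[m2]_(y in D) F (x, y)).
Proof.
rewrite (_ : (fun _ => _) = fubini_F m2 G).
  exact: measurable_fun_fubini_tonelli_F.
by apply/funext => x; rewrite /fubini_F integral_G.
Qed.

Lemma tonelli_in :
  \int[m1]_x \int[m2]_(y in D) F (x, y) = \int[m2]_(y in D) \int[m1]_x F (x, y).
Proof.
transitivity (\int[m1]_x \int[m2]_y G (x, y)).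
  by apply: eq_integral => x _; rewrite integral_G.
rewrite fubini_tonelli// [RHS]integral_mkcond; apply: eq_integral => y _.
rewrite patchE; case: ifPn => yD.
  by apply: eq_integral => x _; rewrite GE patchE yD.
rewrite -[RHS](integral0 m1 setT); apply: eq_integral => x _.
by rewrite GE patchE (negbTE yD).
Qed.

End tonelli_restricted.

(** Exchanging the integrals on both sides puts [m1] inside, so the bound at fixed [y] can be
    integrated over [D]. Later [m1] integrates over [w] and [m2] over one angle of the sphere. *)
Lemma le_tonelli_in d1 d2 (X : measurableType d1) (Y : measurableType d2)
    (R : realType) (m1 : {sigma_finite_measure set X -> \bar R})
    (m2 : {sigma_finite_measure set Y -> \bar R}) (D : set Y)
    (F G : X * Y -> \bar R) (c : R) :
  measurable D -> measurable_fun setT F -> measurable_fun setT G ->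
  (forall x y, D y -> 0 <= F (x, y))%E -> (forall x y, D y -> 0 <= G (x, y))%E ->
  0 <= c ->
  (forall y, D y ->
    \int[m1]_x F (x, y) <= c%:E * \int[m1]_x G (x, y))%E ->
  (\int[m1]_x \int[m2]_(y in D) F (x, y) <=
   c%:E * \int[m1]_x \int[m2]_(y in D) G (x, y))%E.
Proof.
move=> mD mF mG F0 G0 c0 FG; rewrite !tonelli_in//.
have mI (H : X * Y -> \bar R) : measurable_fun setT H ->
    (forall x y, D y -> 0 <= H (x, y))%E ->
    measurable_fun D (fun y => \int[m1]_x H (x, y))%E.
  move=> mH H0; apply/(measurable_restrictT _ _).2 => //.
  rewrite (_ : _ \_ D = fun y => \int[m1]_x (H \_ (setT `*` D)) (x, y))%E.
    apply: measurable_fun_fubini_tonelli_G => [|[x y]].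
      apply/(measurable_restrictT _ _).1; first exact: measurableX.
      exact: measurable_funTS.
    by apply: erestrict_ge0 => -[? ?] [_]; exact: H0.
  apply/funext => y; rewrite patchE; case: ifPn => yD.
    apply: eq_integral => x _; rewrite patchE ifT// inE; split => //.
    exact: set_mem.
  rewrite -[LHS](integral0 m1 setT); apply: eq_integral => x _.
  by rewrite patchE ifF//; apply: contraNF yD; rewrite !inE => -[].
rewrite -ge0_integralZl//; [|exact: mI|].
- apply: ge0_le_integral => //.
  + by move=> y Dy; apply: integral_ge0 => x _; exact: F0.
  + exact: mI.
  + by apply: measurable_funeM; exact: mI.
- by move=> y Dy; apply: integral_ge0 => x _; exact: G0.
Qed.

(** * Translation invariance of Lebesgue measure, on the line and then on [R3] *)

Section translation.
Context {R : realType}.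

(** Lebesgue measure is determined by its values on half-open intervals, and a translation preserves
    their length. *)
Lemma lebesgue_measureD (a : R) (A : set R) : measurable A ->
  pushforward lebesgue_measure
    (fun x : measurableTypeR R => x + a : measurableTypeR R) A
  = lebesgue_measure A.
Proof.
have mt : measurable_fun setT (fun x : measurableTypeR R => x + a : measurableTypeR R).
  exact: measurable_funD.
move=> mA; apply/esym/lebesgue_measure_unique => //= _ [[b c]] _ <-.
rewrite /pushforward.
rewrite (_ : _ @^-1` _ = `](b - a), (c - a)]%classic).
  rewrite !lebesgue_measure_itv/= !lte_fin ltrD2r.
  by case: ifP => // _; rewrite -!EFinB; congr EFin; ring.
by apply/seteqP; split => x/=; rewrite !in_itv/= ltrBlDr lerBrDr.
Qed.

Lemma ge0_integralD_shift (a : R) (f : R -> \bar R) :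
  measurable_fun setT f -> (forall x, 0 <= f x)%E ->
  (\int[lebesgue_measure]_x f (x + a)%R = \int[lebesgue_measure]_x f x)%E.
Proof.
move=> mf f0.
have mt : measurable_fun setT (fun x : measurableTypeR R => x + a : measurableTypeR R).
  exact: measurable_funD.
pose t (x : measurableTypeR R) : measurableTypeR R := x + a.
transitivity (\int[pushforward (@lebesgue_measure R) t]_x f x)%E.
  by rewrite ge0_integral_pushforward.
by apply: eq_measure_integral => //= A mA _; exact: lebesgue_measureD.
Qed.

End translation.

(** Hypotheses and conclusion express invariance in the same form, so two applications reach three
    factors. By Tonelli, [t] is undone in the inner integral and [s] in the outer one. *)
Lemma ge0_integral_sfprod_map d1 d2 (X : measurableType d1)
    (Y : measurableType d2) (R : realType)
    (m1 : {sigma_finite_measure set X -> \bar R})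
    (m2 : {sigma_finite_measure set Y -> \bar R}) (s : X -> X) (t : Y -> Y) :
  measurable_fun setT s -> measurable_fun setT t ->
  (forall f, measurable_fun setT f -> (forall x, 0 <= f x)%E ->
    (\int[m1]_x f (s x) = \int[m1]_x f x)%E) ->
  (forall f, measurable_fun setT f -> (forall x, 0 <= f x)%E ->
    (\int[m2]_x f (t x) = \int[m2]_x f x)%E) ->
  forall f, measurable_fun setT f -> (forall x, 0 <= f x)%E ->
    (\int[sfprod m1 m2]_z f (s z.1, t z.2) = \int[sfprod m1 m2]_z f z)%E.
Proof.
move=> ms mt s_inv t_inv f mf f0.
have mst : measurable_fun setT (fun z : X * Y => (s z.1, t z.2)).
  by apply: measurable_fun_pair; exact: measurableT_comp.
rewrite (fubini_tonelli1 (fun z => f (s z.1, t z.2)))//; last first.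
  exact: measurableT_comp mst.
rewrite [RHS](fubini_tonelli1 f)//.
rewrite -[RHS]s_inv; first last.
- by move=> x; exact: integral_ge0.
- exact: measurable_fun_fubini_tonelli_F.
- apply: eq_integral => x _; rewrite /fubini_F/=.
  apply: (t_inv (fun y => f (s x, y))) => //.
  exact: measurableT_comp.
Qed.

Section translation3.
Context {R : realType}.

Lemma ge0_integral_leb3_sub (a : R3 R) (f : R3 R -> \bar R) :
  measurable_fun setT f -> (forall x, 0 <= f x)%E ->
  (\int[leb3]_w f (sub3 w a) = \int[leb3]_w f w)%E.
Proof.
have ms (b : R) : measurable_fun setT (fun x : measurableTypeR R => x - b).
  exact: measurable_funB.
have inv (b : R) (g : R -> \bar R) : measurable_fun setT g ->
    (forall x, 0 <= g x)%E ->
    (\int[lebesgue_measure]_x g (x - b)%R = \int[lebesgue_measure]_x g x)%E.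
  exact: ge0_integralD_shift.
have ms2 : measurable_fun setT
    (fun z : measurableTypeR R * measurableTypeR R => (z.1 - a.1.1, z.2 - a.1.2)).
  by apply: measurable_fun_pair; exact: measurableT_comp (ms _) _.
move=> mf f0.
apply: (ge0_integral_sfprod_map ms2 (ms a.2) _ (inv a.2) mf f0) => g mg g0.
exact: (ge0_integral_sfprod_map (ms a.1.1) (ms a.1.2) (inv a.1.1) (inv a.1.2) mg g0).
Qed.

End translation3.

(** * Measurability of the Euclidean operations, by coordinates *)

Section measurable_euclidean.
Context d (T : measurableType d) {R : realType}.
Implicit Types f g : T -> R3 R.

Lemma measurable_R3P f : measurable_fun setT f <->
  [/\ measurable_fun setT (fun x => (f x).1.1 : R),
      measurable_fun setT (fun x => (f x).1.2 : R) &
      measurable_fun setT (fun x => (f x).2 : R)].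
Proof.
split=> [mf|[m1 m2 m3]].
  have mf1 := measurableT_comp (@measurable_fst _ _ _ _) mf.
  split.
  - exact: measurableT_comp (@measurable_fst _ _ _ _) mf1.
  - exact: measurableT_comp (@measurable_snd _ _ _ _) mf1.
  - exact: measurableT_comp (@measurable_snd _ _ _ _) mf.
rewrite (_ : f = fun x => ((f x).1.1, (f x).1.2, (f x).2)).
  by apply: measurable_fun_pair => //; exact: measurable_fun_pair.
by apply/funext => x; case: (f x) => -[].
Qed.

Lemma measurable_sub3 f g : measurable_fun setT f -> measurable_fun setT g ->
  measurable_fun setT (fun x => sub3 (f x) (g x)).
Proof.
move=> /measurable_R3P[f1 f2 f3] /measurable_R3P[g1 g2 g3].
by apply/measurable_R3P; split; exact: measurable_funB.
Qed.

Lemma measurable_scale3 (a : T -> R) f :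
  measurable_fun setT a -> measurable_fun setT f ->
  measurable_fun setT (fun x => scale3 (a x) (f x)).
Proof.
move=> ma /measurable_R3P[f1 f2 f3].
by apply/measurable_R3P; split; exact: measurable_funM.
Qed.

Lemma measurable_dot3 f g : measurable_fun setT f -> measurable_fun setT g ->
  measurable_fun setT (fun x => dot3 (f x) (g x)).
Proof.
move=> /measurable_R3P[f1 f2 f3] /measurable_R3P[g1 g2 g3].
by apply: measurable_funD; [apply: measurable_funD|]; exact: measurable_funM.
Qed.

Lemma measurable_norm3 f : measurable_fun setT f ->
  measurable_fun setT (fun x => norm3 (f x)).
Proof.
move=> mf; apply: (measurableT_comp (f := @Num.sqrt R)).
  by apply: continuous_measurable_fun; exact: sqrt_continuous.
exact: measurable_dot3.
Qed.

Lemma measurable_sphere_pt (a b : T -> R) :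
  measurable_fun setT a -> measurable_fun setT b ->
  measurable_fun setT (fun x => sphere_pt (a x) (b x)).
Proof.
move=> ma mb.
have ms : measurable_fun setT (@sin R).
  by apply: continuous_measurable_fun; exact: continuous_sin.
have mc : measurable_fun setT (@cos R).
  by apply: continuous_measurable_fun; exact: continuous_cos.
have [msa mca] := (measurableT_comp ms ma, measurableT_comp mc ma).
have [msb mcb] := (measurableT_comp ms mb, measurableT_comp mc mb).
by apply/measurable_R3P; split => //; exact: measurable_funM.
Qed.

End measurable_euclidean.

(** * Averaging over translations along one direction *)

Section averaging.
Context {R : realType}.

Lemma dot3_sub3_scale3 (v w e : R3 R) (z : R) (e1 : R3 R) :
  dot3 (sub3 v (sub3 w (scale3 z e))) e1 = dot3 (sub3 v w) e1 + z * dot3 e e1.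
Proof. by rewrite /dot3/=; ring. Qed.

(* Insert [1 = \int_z 1_[2, 3] (x w + z)], move [w] by [- z e] and integrate in
   [z] first: [z] then only occurs in [k (x w - z)]. *)
Lemma integral_averaging (v e : R3 R) (K : R) (k : R -> \bar R)
    (H : R3 R -> \bar R) :
  let x w := dot3 (sub3 v w) e in
  dot3 e e = 1 -> 0 <= K ->
  measurable_fun setT k -> (forall s, 0 <= k s)%E ->
  (forall s, k (- s) = k s) -> (forall s, 1 < `|s| -> k s = 0%E) ->
  measurable_fun setT H -> (forall w, 0 <= H w)%E ->
  (forall w z, `|x w| <= 1 -> 2 <= x w + z -> x w + z <= 3 ->
    (H w <= K%:E * H (sub3 w (scale3 z e)))%E) ->
  (\int[leb3]_w (k (x w) * H w) <=
   K%:E * (\int[lebesgue_measure]_s k s * \int[leb3]_w H w))%E.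
Proof.
move=> x e1 K0 mk k0 kN k_supp mH H0 HK.
(* The interval has length one, so integrating [J] in [z] inserts the factor 1. It lies beyond
   [-1, 1], outside which [k] vanishes, so the translation increases the modulus of the coordinate
   [x]. *)
pose J (s : R) : \bar R := (\1_(`[2, 3]%classic : set R) s)%:E.
have mJ : measurable_fun setT J.
  by apply/measurable_EFinP; exact: measurable_indic.
have J0 s : (0 <= J s)%E by rewrite lee_fin.
have mx : measurable_fun setT x.
  apply: measurable_dot3; last exact: measurable_cst.
  by apply: measurable_sub3; [exact: measurable_cst|exact: measurable_id].
have mx1 : measurable_fun setT (fun u : R3 R * R => x u.1).
  exact: measurableT_comp.
have mz : measurable_fun setT (fun u : R3 R * R => u.2) by exact: measurable_snd.
have mH1 : measurable_fun setT (fun u : R3 R * R => H u.1).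
  exact: measurableT_comp.
(* Moving [w] by [- z e] turns [x w] into [x w + z]. There [G] carries the same factors [J] and [k]
   as [F] at [w]; only the argument of [H] differs. *)
pose F (u : R3 R * R) : \bar R := (J (x u.1 + u.2)%R * (k (x u.1) * H u.1))%E.
pose G (u : R3 R * R) : \bar R := (J (x u.1) * (k (x u.1 - u.2)%R * H u.1))%E.
have mF : measurable_fun setT F.
  apply: emeasurable_funM.
    by apply: measurableT_comp mJ _; exact: measurable_funD.
  by apply: emeasurable_funM => //; exact: measurableT_comp mk _.
have mG : measurable_fun setT G.
  apply: emeasurable_funM; first exact: measurableT_comp mJ _.
  apply: emeasurable_funM => //.
  by apply: measurableT_comp mk _; exact: measurable_funB.
have F0 u : (0 <= F u)%E by rewrite !mule_ge0.
have G0 u : (0 <= G u)%E by rewrite !mule_ge0.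
have intF w : (\int[lebesgue_measure]_z F (w, z) = k (x w) * H w)%E.
  under eq_integral do rewrite /F/= muleC.
  rewrite ge0_integralZl//; last 2 first.
  - by apply: measurableT_comp mJ _; exact: measurable_funD.
  - exact: mule_ge0.
  under eq_integral do rewrite addrC.
  rewrite ge0_integralD_shift// /J integral_indic//= setIT.
  rewrite lebesgue_measure_itv/= lte_fin ifT; last by lra.
  by rewrite -EFinB (_ : 3 - 2 = 1 :> R) ?mule1//; lra.
have intG w : (\int[lebesgue_measure]_z G (w, z) <=
    \int[lebesgue_measure]_s k s * H w)%E.
  (* Evenness of [k] turns [k (x w - z)] into [k (z - x w)], a translate in [z]. *)
  under eq_integral do rewrite /G/= muleCA -kN opprB.
  rewrite ge0_integralZr//; last 2 first.
  - by apply: measurableT_comp mk _; exact: measurable_funB.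
  - exact: mule_ge0.
  rewrite (ge0_integralD_shift (- x w) mk)//.
  apply: lee_wpmul2l; first exact: integral_ge0.
  rewrite -[leRHS]mul1e; apply: lee_wpmul2r => //.
  by rewrite lee_fin indicE lern1 leq_b1.
under eq_integral do rewrite -intF.
apply: (@le_trans _ _ (K%:E * \int[leb3]_w \int[lebesgue_measure]_z G (w, z))%E).
  apply: le_tonelli_in => // z _.
  rewrite -(@ge0_integral_leb3_sub _ (scale3 z e) (fun w => G (w, z))); last 2 first.
  - exact: measurable_fun_pair1 mG.
  - by move=> w; exact: G0.
  have mGz : measurable_fun setT (fun w : R3 R => G (sub3 w (scale3 z e), z)).
    apply: (measurableT_comp (f := fun w => G (w, z))) => //.
      exact: measurable_fun_pair1 mG.
    by apply: measurable_sub3; [exact: measurable_id|exact: measurable_cst].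
  rewrite -ge0_integralZl//.
  apply: ge0_le_integral => //.
  - exact: measurable_fun_pair1 mF.
  - exact: measurable_funeM.
  move=> w _; rewrite /F /G/=.
  have -> : x (sub3 w (scale3 z e)) = x w + z.
    by rewrite /x dot3_sub3_scale3 e1 mulr1.
  rewrite addrK [leRHS]muleCA.
  (* The three bounds required by [HK] may be assumed: otherwise [k (x w)] or [J (x w + z)]
     vanishes. *)
  have [xw1|xw1] := leP `|x w| 1; last by rewrite k_supp// !mul0e !mule0.
  have [zlo|zlo] := leP 2 (x w + z); last first.
    rewrite /J indicE memNset ?mul0e ?mule0// /= in_itv/=.
    by move=> /andP[]; rewrite leNgt zlo.
  have [zhi|zhi] := leP (x w + z) 3; last first.
    rewrite /J indicE memNset ?mul0e ?mule0// /= in_itv/=.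
    by move=> /andP[_]; rewrite leNgt zhi.
  by apply: lee_wpmul2l => //; rewrite [leRHS]muleCA; apply: lee_wpmul2l => //; exact: HK.
apply: lee_wpmul2l; first by rewrite lee_fin.
rewrite -ge0_integralZl//; last exact: integral_ge0.
apply: ge0_le_integral => //.
- by move=> w _; exact: integral_ge0.
- exact: measurable_fun_fubini_tonelli_F.
- exact: measurable_funeM.
Qed.

End averaging.

(** * A dyadic substitute for the inverse square root *)

Section dyadic_kernel.
Context {R : realType}.

(* The sum of the terms is comparable to [|s|^(-1/2)] on [[-1, 1]], but is
   infinite at [0] and has an explicit integral. *)
Definition dyadic_term (n : nat) (s : R) : \bar R :=
  (2 ^+ n * \1_(`[- 4^-1 ^+ n, 4^-1 ^+ n]%classic : set R) s)%:E.

Definition dyadic_kernel (s : R) : \bar R :=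
  (\sum_(n <oo) dyadic_term n s)%E.

Lemma dyadic_term_ge0 n s : (0 <= dyadic_term n s)%E.
Proof. by rewrite lee_fin mulr_ge0// exprn_ge0. Qed.

Lemma measurable_dyadic_term n : measurable_fun setT (dyadic_term n).
Proof.
apply/measurable_EFinP; apply: measurable_funM; first exact: measurable_cst.
exact: measurable_indic.
Qed.

Lemma dyadic_kernel_ge0 s : (0 <= dyadic_kernel s)%E.
Proof. by apply: nneseries_ge0 => n _ _; exact: dyadic_term_ge0. Qed.

Lemma measurable_dyadic_kernel : measurable_fun setT dyadic_kernel.
Proof.
apply: ge0_emeasurable_sum => [n s _ _|n _]; first exact: dyadic_term_ge0.
exact: measurable_dyadic_term.
Qed.

Lemma dyadic_kernelN s : dyadic_kernel (- s) = dyadic_kernel s.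
Proof.
apply: eq_eseriesr => n _; congr (_ * _)%:E; rewrite !indicE; congr ((nat_of_bool _)%:R).
by apply/idP/idP; rewrite !inE/= !in_itv/= => /andP[? ?]; apply/andP; split; lra.
Qed.

Lemma dyadic_kernel_eq0 s : 1 < `|s| -> dyadic_kernel s = 0%E.
Proof.
move=> s1; apply: eseries0 => n _ _; rewrite /dyadic_term indicE memNset ?mulr0//=.
rewrite in_itv/= -ler_norml => /(lt_le_trans s1); apply/negP; rewrite -leNgt.
by rewrite exprn_ile1// ?invr_ge0// invf_le1// ler1n.
Qed.

(** Term [n] contributes 2^n * 2 * 4^-n = 4 / 2^(n+1), and this geometric series sums to 4. *)
Lemma integral_dyadic_kernel :
  (\int[lebesgue_measure]_s dyadic_kernel s = 4%:E)%E.
Proof.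
rewrite integral_nneseries//; last 2 first.
- exact: measurable_dyadic_term.
- by move=> n s _; exact: dyadic_term_ge0.
transitivity (\sum_(n <oo) (4 / (2 ^ (n + 1))%:R : R)%:E)%E.
  apply: eq_eseriesr => n _; rewrite /dyadic_term.
  under eq_integral do rewrite EFinM.
  rewrite ge0_integralZl_EFin ?exprn_ge0//; last first.
    apply: measurableT_comp => //; exact: measurable_indic.
  rewrite integral_indic//= setIT lebesgue_measure_itv/= lte_fin.
  have p4 : 0 < 4^-1 ^+ n :> R by rewrite exprn_gt0// invr_gt0.
  rewrite ifT; last by lra.
  rewrite -EFinB -EFinM opprK; congr EFin.
  rewrite natrX addn1 exprS exprVn -(_ : 2 ^+ n * 2 ^+ n = 4 ^+ n :> R).
    by field; rewrite expf_neq0.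
  by rewrite -exprMn; congr (_ ^+ _); ring.
have := @cvg_geometric_eseries_half R 4 0; rewrite expr0 divr1.
by move=> /cvg_lim; apply.
Qed.

(** Term [n] alone gives the bound; it is the last one of the partial sum of length [n.+1]. *)
Lemma dyadic_kernel_ge n s : `|s| <= 4^-1 ^+ n -> ((2 ^+ n)%:E <= dyadic_kernel s)%E.
Proof.
move=> sn; apply: le_trans (nneseries_lim_ge n.+1 _); last first.
  by move=> m _ _; exact: dyadic_term_ge0.
rewrite big_nat_recr//= /dyadic_term indicE mem_set ?mulr1; last first.
  by rewrite /= in_itv/= -ler_norml.
by rewrite leeDr// sume_ge0// => i _; exact: dyadic_term_ge0.
Qed.

(** The least [n] satisfying the first inequality works: minimality gives the second one, which for
    [n = 0] is the hypothesis [r <= 1]. *)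
Lemma dyadic_scale (r : R) : 0 < r -> r <= 1 ->
  exists n, 4^-1 ^+ n.+1 < r /\ r <= 4^-1 ^+ n.
Proof.
move=> r0 r1.
have exn : exists n, 4^-1 ^+ n.+1 < r.
  exists (Num.bound r^-1); rewrite exprVn invf_plt ?posrE ?exprn_gt0//.
  rewrite (lt_trans (archi_boundP _)) ?invr_ge0 ?(ltW r0)//.
  by rewrite -natrX ltr_nat (ltn_trans (ltnSn _))// ltn_expl.
case: (ex_minnP exn) => -[|n] nr minn.
  by exists 0%N; rewrite expr0.
exists n.+1; split => //; rewrite leNgt; apply/negP => /minn.
by rewrite ltnn.
Qed.

End dyadic_kernel.

(** * Absorbing the singularity of 1 / |q| *)

Section singular_weight.
Context {R : realType}.
Implicit Types v w e : R3 R.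

Lemma dot3_ge0 v : 0 <= dot3 v v.
Proof. by rewrite /dot3 !addr_ge0// -expr2 sqr_ge0. Qed.

Lemma norm3_ge0 v : 0 <= norm3 v.
Proof. exact: sqrtr_ge0. Qed.

Lemma sqr_norm3 v : norm3 v ^+ 2 = dot3 v v.
Proof. by rewrite sqr_sqrtr// dot3_ge0. Qed.

(** Cauchy-Schwarz: the part of [v] orthogonal to [e] has nonnegative squared length. *)
Lemma norm3_dot3_le v e : dot3 e e = 1 -> `|dot3 v e| <= norm3 v.
Proof.
move=> e1; rewrite -(@ler_pXn2r _ 2)// ?nnegrE ?norm3_ge0//.
rewrite sqr_norm3 real_normK ?num_real// -subr_ge0.
have := dot3_ge0 (sub3 v (scale3 (dot3 v e) e)).
congr (0 <= _); transitivity
  (dot3 v v - 2 * dot3 v e ^+ 2 + dot3 v e ^+ 2 * dot3 e e).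
  by rewrite {1}/dot3 /sub3 /scale3/=; rewrite /dot3; ring.
by rewrite e1; ring.
Qed.

Lemma measurable_dot3_sub3 v e : measurable_fun setT (fun w => dot3 (sub3 v w) e).
Proof.
apply: measurable_dot3; last exact: measurable_cst.
by apply: measurable_sub3; [exact: measurable_cst|exact: measurable_id].
Qed.

(** If |q| >= 1 then [Gt <= G]. If 0 < |q| < 1, then 1 / |q| is at most 4 times the product of the
    dyadic kernels of the two coordinates of q, and each kernel is averaged out at the cost of a
    factor 4 K. Altogether this gives 1 + 4 (4 K)^2. *)
Lemma integral_le_norm3 v e1 e2 (K : R) (G Gt : R3 R -> \bar R) :
  dot3 e1 e1 = 1 -> dot3 e2 e2 = 1 -> dot3 e1 e2 = 0 -> 0 <= K ->
  measurable_fun setT G -> measurable_fun setT Gt ->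
  (forall w, 0 <= Gt w)%E ->
  (forall w, norm3 (sub3 v w) = 0 -> Gt w = 0%E) ->
  (forall w, G w = (norm3 (sub3 v w))%:E * Gt w)%E ->
  (forall e, e = e1 \/ e = e2 -> forall w z, `|dot3 (sub3 v w) e| <= 1 ->
    2 <= dot3 (sub3 v w) e + z -> dot3 (sub3 v w) e + z <= 3 ->
    (G w <= K%:E * G (sub3 w (scale3 z e)))%E) ->
  (\int[leb3]_w Gt w <= (1 + 64 * K ^+ 2)%:E * \int[leb3]_w G w)%E.
Proof.
move=> e11 e22 e12 K0 mG mGt Gt0 Gt_eq0 GE GK.
have G0 w : (0 <= G w)%E by rewrite GE mule_ge0// lee_fin norm3_ge0.
pose k1 w := dyadic_kernel (dot3 (sub3 v w) e1).
pose k2 w := dyadic_kernel (dot3 (sub3 v w) e2).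
have k10 w : (0 <= k1 w)%E by exact: dyadic_kernel_ge0.
have k20 w : (0 <= k2 w)%E by exact: dyadic_kernel_ge0.
have mk1 : measurable_fun setT k1.
  by apply: measurableT_comp (measurable_dot3_sub3 _ _); exact: measurable_dyadic_kernel.
have mk2 : measurable_fun setT k2.
  by apply: measurableT_comp (measurable_dot3_sub3 _ _); exact: measurable_dyadic_kernel.
pose P w := (k1 w * (k2 w * G w))%E.
have mk2G : measurable_fun setT (fun w => k2 w * G w)%E by exact: emeasurable_funM.
have mP : measurable_fun setT P by exact: emeasurable_funM.
have P0 w : (0 <= P w)%E by rewrite !mule_ge0.
have intP : (\int[leb3]_w P w <= (16 * K ^+ 2)%:E * \int[leb3]_w G w)%E.
  apply: (@le_trans _ _ (K%:E * (4%:E * \int[leb3]_w (k2 w * G w)))%E).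
    rewrite -[4%:E]integral_dyadic_kernel.
    apply: integral_averaging => //.
    - exact: measurable_dyadic_kernel.
    - exact: dyadic_kernel_ge0.
    - exact: dyadic_kernelN.
    - exact: dyadic_kernel_eq0.
    - by move=> w; rewrite mule_ge0.
    (* A translation along [e1] keeps the coordinate along [e2], hence [k2], so [k2 G] inherits the
       hypothesis on [G]. The second averaging, along [e2], then removes [k2]. *)
    move=> w z x1 x2 x3; rewrite muleCA /k2 dot3_sub3_scale3 e12 mulr0 addr0.
    by apply: lee_wpmul2l; [exact: k20|apply: GK => //; left].
  apply: (@le_trans _ _ (K%:E * (4%:E * (K%:E * (4%:E * \int[leb3]_w G w))))%E).
    apply: lee_wpmul2l => //; apply: lee_wpmul2l => //.
    rewrite -[4%:E]integral_dyadic_kernel.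
    apply: integral_averaging => //.
    - exact: measurable_dyadic_kernel.
    - exact: dyadic_kernel_ge0.
    - exact: dyadic_kernelN.
    - exact: dyadic_kernel_eq0.
    by apply: GK; right.
  rewrite !muleA -!EFinM; apply: lee_wpmul2r; first exact: integral_ge0.
  by rewrite (_ : K * 4 * K * 4 = 16 * K ^+ 2)//; ring.
have GtP w : (Gt w <= G w + 4%:E * P w)%E.
  set q := norm3 (sub3 v w).
  have [q1|q1] := leP 1 q.
    apply: (@le_trans _ _ (G w)); last by rewrite leeDl// mule_ge0.
    by rewrite GE -[leLHS]mul1e lee_wpmul2r// lee_fin.
  (* For [q = 0] the identity [GE] says nothing about [Gt], whence the separate hypothesis
     [Gt_eq0]. *)
  have [q0|q0] := eqVneq q 0.
    by rewrite Gt_eq0// adde_ge0// mule_ge0.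
  have {}q0 : 0 < q by rewrite lt_neqAle eq_sym q0 norm3_ge0.
  (* Both coordinates are at most q <= 4^-N in modulus, so each kernel is at least 2^N, while
     4^-(N+1) < q gives 1 <= 4 * 2^N * 2^N * q. *)
  have [N [Nq qN]] := dyadic_scale q0 (ltW q1).
  apply: (@le_trans _ _ (4%:E * P w)%E); last by rewrite leeDr.
  apply: (@le_trans _ _ (4%:E * ((2 ^+ N)%:E * ((2 ^+ N)%:E * G w)))%E).
    rewrite GE -/q !muleA -!EFinM -[leLHS]mul1e lee_wpmul2r// lee_fin.
    rewrite -(@ler_pM2l _ (4^-1 ^+ N.+1)) ?exprn_gt0 ?invr_gt0// mulr1.
    rewrite (le_trans (ltW Nq))// le_eqVlt; apply/orP; left; apply/eqP.
    rewrite exprVn -!mulrA [2 ^+ N * _]mulrA -exprMn (_ : 2 * 2 = 4 :> R); last by ring.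
    by rewrite exprS; field; rewrite expf_neq0.
  apply: lee_wpmul2l => //.
  apply: lee_pmul.
  - by rewrite lee_fin exprn_ge0.
  - by rewrite mule_ge0// lee_fin exprn_ge0.
  - by apply: dyadic_kernel_ge; rewrite (le_trans _ qN)// norm3_dot3_le.
  - apply: lee_wpmul2r => //.
    by apply: dyadic_kernel_ge; rewrite (le_trans _ qN)// norm3_dot3_le.
apply: (@le_trans _ _ (\int[leb3]_w (G w + 4%:E * P w))%E).
  apply: ge0_le_integral => //.
  by apply: emeasurable_funD => //; exact: measurable_funeM.
rewrite ge0_integralD//; last 2 first.
- by move=> w _; rewrite mule_ge0.
- exact: measurable_funeM.
rewrite ge0_integralZl// [(1 + _)%:E]EFinD [leRHS]ge0_muleDl ?lee_fin ?mulr_ge0 ?sqr_ge0//.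
rewrite mul1e; apply: leeD2l; rewrite (_ : 64 * K ^+ 2 = 4 * (16 * K ^+ 2)); last by ring.
by rewrite EFinM -muleA lee_wpmul2l.
Qed.

End singular_weight.

(** * Convexity: monotone derivative, sign and measurability of [Psi] *)

Section convex_entropy.
Context {R : realType}.
Variable Phi : R -> R.
Hypotheses (cPhi : convex_function (`[0, +oo[%classic : set R^o) Phi)
  (dPhi_gt0 : forall x : R, 0 < x -> derivable Phi x 1).

(** Convexity with weight (y - z) / (y - x) on [x], multiplied by [y - x] so that no quotient
    remains. *)
Lemma convex_chord (x z y : R) : 0 <= x -> x < z -> z < y ->
  (y - x) * Phi z <= (y - z) * Phi x + (z - x) * Phi y.
Proof.
move=> x0 xz zy.
have xy : 0 < y - x by rewrite subr_gt0 (lt_trans xz).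
have t0 : 0 <= (y - z) / (y - x) by rewrite divr_ge0 ?ltW// subr_gt0.
have t1 : (y - z) / (y - x) <= 1 by rewrite ler_pdivrMr// mul1r; lra.
have := cPhi (Itv01 t0 t1) (x := x) (y := y).
rewrite !inE/= !in_itv/= !andbT x0 => /(_ isT).
have y0 : 0 <= y by rewrite (le_trans x0)// ltW// (lt_trans xz).
move=> /(_ y0); rewrite !convRE/= /onem.
set u := conv _ _ _; have -> : u = z.
  transitivity ((y - z) / (y - x) * x + (1 - (y - z) / (y - x)) * y) => //.
  by field; lra.
rewrite -(ler_pM2l xy) => /le_trans; apply.
rewrite le_eqVlt; apply/orP; left; apply/eqP.
by field; lra.
Qed.

(** The slope [sl] of the chord separates the two derivatives, computed as a right limit at [x] and
    a left limit at [y]. *)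
Lemma derive1_le (x y : R) : 0 < x -> x < y -> derive1 Phi x <= derive1 Phi y.
Proof.
move=> x0 xy; have y0 := lt_trans x0 xy.
pose sl := (Phi y - Phi x) / (y - x).
have yx : 0 < y - x by rewrite subr_gt0.
have cvgD (z : R) : 0 < z -> cvg ((fun h => h^-1 *: (Phi (h + z) - Phi z)) @ 0^').
  move=> z0; have := dPhi_gt0 z0; rewrite /derivable.
  by under eq_fun do rewrite /= /GRing.scale/= mulr1.
apply: (@le_trans _ _ sl).
  rewrite /derive1 cvg_at_rightE; last exact: cvgD.
  apply: limr_le.
    by have /cvg_ex[l /cvg_dnbhs_at_right fl] := cvgD _ x0; apply/cvg_ex; exists l.
  near=> h; have h0 : 0 < h by near: h; exact: nbhs_right_gt.
  have hyx : h < y - x by near: h; exact: nbhs_right_lt.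
  rewrite /sl /GRing.scale/= ler_pdivlMr// -mulrA ler_pdivrMl//.
  by have := @convex_chord x (h + x) y (ltW x0); nra.
rewrite /derive1 cvg_at_leftE; last exact: cvgD.
apply: limr_ge.
  by have /cvg_ex[l /cvg_dnbhs_at_left fl] := cvgD _ y0; apply/cvg_ex; exists l.
near=> h; have h0 : h < 0 by near: h; exact: nbhs_left_lt.
have hyx : x - y < h by near: h; apply: nbhs_left_gt; rewrite subr_lt0.
rewrite /sl /GRing.scale/= ler_pdivrMr// -mulrA ler_ndivlMl//.
by have := @convex_chord x (h + y) y (ltW x0); nra.
Unshelve. all: by end_near. Qed.

(** By monotonicity the limit at 0+ exists in the extended reals and is the infimum of the
    derivative over positive arguments. *)
Lemma dPhi0_le (y : R) : 0 < y -> (dPhi Phi 0 <= dPhi Phi y)%E.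
Proof.
move=> y0; rewrite /dPhi eqxx gt_eqF//.
have nd : {in `]0, +oo[ &, {homo (fun y : R => (derive1 Phi y)%:E) :
    x z / x <= z >-> (x <= z)%E}}.
  move=> a b; rewrite !in_itv/= !andbT => a0 b0.
  rewrite le_eqVlt => /predU1P[->//|ab]; rewrite lee_fin; exact: derive1_le.
have /cvg_lim -> // := @nondecreasing_at_right_cvge R _ 0 +oo%O isT nd.
by apply: ereal_inf_lbound; exists y => //=; rewrite in_itv/= y0.
Qed.

Lemma dPhi_le (x y : R) : 0 <= x -> x <= y -> (dPhi Phi x <= dPhi Phi y)%E.
Proof.
rewrite le_eqVlt => /predU1P[<-|x0].
  by rewrite le_eqVlt => /predU1P[<-//|]; exact: dPhi0_le.
rewrite le_eqVlt => /predU1P[<-//|xy].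
by rewrite /dPhi (gt_eqF x0) (gt_eqF (lt_trans x0 xy)) lee_fin derive1_le.
Qed.

Lemma dPhi_fin_num (x : R) : 0 < x -> dPhi Phi x \is a fin_num.
Proof. by move=> x0; rewrite /dPhi gt_eqF. Qed.

(** If [x] and [y] differ, the larger one is positive and its [dPhi] is finite, so the difference is
    never indeterminate and has the sign of [x - y]. *)
Lemma Psi_ge0 (x y : R) : 0 <= x -> 0 <= y -> (0 <= Psi Phi x y)%E.
Proof.
move=> x0 y0; rewrite /Psi; case: ifPn => // _.
have [xy|yx|->] := ltgtP x y; last by rewrite subrr mul0e.
- apply: mule_le0; first by rewrite lee_fin subr_le0 ltW.
  by rewrite sube_le0 dPhi_le// ltW.
- apply: mule_ge0; first by rewrite lee_fin subr_ge0 ltW.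
  by rewrite sube_ge0 ?(dPhi_fin_num (le_lt_trans y0 yx)) ?orbT// dPhi_le// ltW.
Qed.

Lemma measurable_Psi d (T : measurableType d) (g h : T -> R) :
  measurable_fun setT g -> measurable_fun setT h ->
  (forall t, 0 <= g t) -> (forall t, 0 <= h t) ->
  measurable_fun setT (fun t => Psi Phi (g t) (h t)).
Proof.
move=> mg mh g0 h0.
(* Continued to negative arguments by its value at 0, [dPhi Phi] is monotone on the whole line, so
   preimages of rays are intervals. *)
pose D (x : R) := dPhi Phi (Num.max x 0).
have mD : measurable_fun setT D.
  have nd : {homo D : x y / x <= y >-> (x <= y)%E}.
    by move=> x y xy; rewrite dPhi_le ?ge_max ?le_max ?xy ?lexx ?orbT.
  apply: (measurability _ (ErealGenOInfty.measurableE R)).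
  move=> _ [_ [r ->]] <-; rewrite setTI; apply: is_interval_measurable => a b/=.
  rewrite !in_itv/= !andbT => ra rb c /andP[ac cb].
  by rewrite in_itv/= andbT (lt_le_trans ra)// nd.
have mDf (f : T -> R) : measurable_fun setT f -> (forall t, 0 <= f t) ->
    measurable_fun setT (fun t => dPhi Phi (f t)).
  move=> mf f0; rewrite (_ : (fun _ => _) = D \o f).
    exact: measurableT_comp.
  by apply/funext => t; rewrite /D/= max_l.
have m0 (f : T -> R) : measurable_fun setT f -> measurable_fun setT (fun t => f t == 0).
  by move=> mf; apply: measurable_fun_eqr.
rewrite /Psi; apply: measurable_fun_ifT.
- by apply: measurable_and; exact: m0.
- exact: measurable_cst.
- apply: emeasurable_funM.
    by apply/measurable_EFinP; exact: measurable_funB.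
  by apply: emeasurable_funB; exact: mDf.
Qed.

End convex_entropy.

Lemma measurable_fun_nneg_div d (T : measurableType d) {R : realType}
    (g h : T -> R) :
  measurable_fun setT g -> measurable_fun setT h -> (forall t, 0 <= h t) ->
  measurable_fun setT (fun t => g t / h t).
Proof.
(* For nonnegative [h] the power -1 is the inverse, including at 0, where both are 0. *)
move=> mg mh h0; rewrite (_ : (fun t => _) = fun t => g t * h t `^ (-1)).
  apply: measurable_funM => //.
  by apply: (measurableT_comp (f := fun x : R => x `^ (-1))) => //; exact: measurable_powR.
by apply/funext => t; rewrite powR_inv1.
Qed.

(** * Effect of the translations on the Maxwellian and on the kernel *)

Section collision_geometry.
Context {R : realType}.
Variables (u0 : R3 R) (theta : R).
Hypothesis theta_gt0 : 0 < theta.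
Implicit Types v w n e : R3 R.

Let M := maxwellian u0 theta.

Lemma maxwellian_gt0 v : 0 < M v.
Proof. by rewrite /M /maxwellian mulr_gt0 ?expR_gt0// powR_gt0// !mulr_gt0// pi_gt0. Qed.

Lemma measurable_maxwellian : measurable_fun setT M.
Proof.
apply: measurable_funM; first exact: measurable_cst.
apply: (measurableT_comp (f := @expR R)) => //.
apply: measurableT_comp => //; apply: measurable_funM; last exact: measurable_cst.
apply: measurable_funX; apply: measurable_norm3.
by apply: measurable_sub3; [exact: measurable_id|exact: measurable_cst].
Qed.

(* With [x], [c] the coordinates of [v - w], [v - u0] along [e], the squared
   distance of [w] to [u0] grows by [(x + z - c)^2 - (x - c)^2 <= 9]. *)
Lemma maxwellian_shift v w e (z : R) : dot3 e e = 1 ->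
  0 <= dot3 (sub3 v u0) e ->
  `|dot3 (sub3 v w) e| <= 1 ->
  2 <= dot3 (sub3 v w) e + z -> dot3 (sub3 v w) e + z <= 3 ->
  M w <= expR (9 / (2 * theta)) * M (sub3 w (scale3 z e)).
Proof.
move=> e1 c0 x1 x2 x3; rewrite /M /maxwellian mulrCA ler_wpM2l ?powR_ge0//.
rewrite -expRD ler_expR !sqr_norm3.
set c := dot3 (sub3 v u0) e in c0; set x := dot3 (sub3 v w) e in x1 x2 x3.
have -> : dot3 (sub3 (sub3 w (scale3 z e)) u0) (sub3 (sub3 w (scale3 z e)) u0) =
    dot3 (sub3 w u0) (sub3 w u0) + (z + x - c) ^+ 2 - (x - c) ^+ 2.
  transitivity (dot3 (sub3 w u0) (sub3 w u0) - 2 * z * (c - x) + z ^+ 2 * dot3 e e).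
    by rewrite /c /x /dot3/=; ring.
  by rewrite e1; ring.
rewrite -subr_ge0 [leRHS](_ : _ =
  (9 + (x - c) ^+ 2 - (z + x - c) ^+ 2) / (2 * theta)); last by ring.
rewrite divr_ge0 ?mulr_ge0 ?(ltW theta_gt0)//.
move: x1; rewrite ler_norml => /andP[x1 x1'].
(* If z + x <= c, then x <= 1 < z + x and [w] moves closer to [u0]. Otherwise 0 < z + x - c <= 3,
   because c >= 0. *)
have [|] := leP (z + x) c; nra.
Qed.

(** For nonzero q the factor |q| cancels the denominator of xi: what remains is |q . n| /
    [b_norm eps] times the indicator of |q . n| / |q| <= eps. The translation keeps q . n and
    increases |q|, so the indicator can only rise. *)
Lemma B_eps_shift eps v w n e (z : R) : 0 < eps -> dot3 e e = 1 ->
  dot3 e n = 0 -> `|dot3 (sub3 v w) e| <= 1 -> 2 <= dot3 (sub3 v w) e + z ->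
  B_eps eps (norm3 (sub3 v w)) (coll_xi v w n) <=
  B_eps eps (norm3 (sub3 v (sub3 w (scale3 z e))))
    (coll_xi v (sub3 w (scale3 z e)) n).
Proof.
move=> eps0 e1 en x1 x2; set w' := sub3 w _.
have qq' : norm3 (sub3 v w) <= norm3 (sub3 v w').
  rewrite /norm3 ler_wsqrtr//.
  have -> : dot3 (sub3 v w') (sub3 v w') = dot3 (sub3 v w) (sub3 v w) +
      (dot3 (sub3 v w) e + z) ^+ 2 - dot3 (sub3 v w) e ^+ 2.
    transitivity (dot3 (sub3 v w) (sub3 v w) + 2 * z * dot3 (sub3 v w) e
        + z ^+ 2 * dot3 e e); first by rewrite /w' /dot3/=; ring.
    by rewrite e1; ring.
  by move: x1; rewrite ler_norml => /andP[? ?]; nra.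
have bn0 : 0 < b_norm eps.
  by rewrite b_normE// !mulr_gt0 ?pi_gt0 ?exprn_gt0.
have s' : dot3 (sub3 v w') n = dot3 (sub3 v w) n.
  by rewrite /w' dot3_sub3_scale3 en mulr0 addr0.
rewrite /B_eps /b_eps /coll_xi s'.
move: (norm3_ge0 (sub3 v w)) qq'.
move: (norm3 (sub3 v w)) (norm3 (sub3 v w')) => q q' q0 qq'.
have [->|qn0] := eqVneq q 0.
  have q'0 := le_trans q0 qq'.
  by rewrite mul0r mulr_ge0// mulr_ge0// divr_ge0 ?(ltW bn0)// divr_ge0.
have {q0 qn0} q0 : 0 < q by rewrite lt_neqAle eq_sym qn0.
have q'0 := lt_le_trans q0 qq'.
rewrite [leLHS](_ : _ = `|dot3 (sub3 v w) n| / b_norm eps *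
  \1_`[0, eps] (`|dot3 (sub3 v w) n| / q)); last by field; rewrite !gt_eqF.
rewrite [leRHS](_ : _ = `|dot3 (sub3 v w) n| / b_norm eps *
  \1_`[0, eps] (`|dot3 (sub3 v w) n| / q')); last by field; rewrite !gt_eqF.
apply: ler_wpM2l; first by rewrite divr_ge0// ltW.
rewrite !indicE ler_nat.
have [|//] := boolP (_ \in _); rewrite inE/= in_itv/= => /andP[_ h].
rewrite mem_set//= in_itv/= divr_ge0//=; last exact: ltW.
by rewrite (le_trans _ h)// ler_wpM2l// lef_pV2.
Qed.

Lemma post_velocity_shift v w n e (z : R) : dot3 e n = 0 ->
  post_velocity v (sub3 w (scale3 z e)) n = post_velocity v w n.
Proof. by move=> en; rewrite /post_velocity dot3_sub3_scale3 en mulr0 addr0. Qed.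

Lemma coll_xi_eq0 v w n : norm3 (sub3 v w) = 0 -> coll_xi v w n = 0.
Proof. by move=> q0; rewrite /coll_xi q0 invr0 mulr0. Qed.

(** Unit vectors in the directions of increasing polar angle and azimuth; the latter omits the
    factor sin t, so it stays a unit vector at the poles. *)
Definition sphere_e1 (t p : R) : R3 R := (cos t * cos p, cos t * sin p, - sin t).
Definition sphere_e2 (t p : R) : R3 R := (- sin p, cos p, 0).

(** The tangent vectors may be replaced by their opposites; the signs are chosen to give [v]
    nonnegative coordinates, as [maxwellian_shift] requires of [v - u0]. *)
Lemma sphere_frame v (t p : R) : exists e1 e2,
  [/\ dot3 e1 e1 = 1, dot3 e2 e2 = 1, dot3 e1 e2 = 0 &
    forall e, e = e1 \/ e = e2 ->
      dot3 e (sphere_pt t p) = 0 /\ 0 <= dot3 v e].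
Proof.
have ct := cos2Dsin2 t; have cp := cos2Dsin2 p.
have e11 : dot3 (sphere_e1 t p) (sphere_e1 t p) = 1.
  transitivity (cos t ^+ 2 * (cos p ^+ 2 + sin p ^+ 2) + sin t ^+ 2).
    by rewrite /dot3/=; ring.
  by rewrite cp mulr1.
have e22 : dot3 (sphere_e2 t p) (sphere_e2 t p) = 1.
  by rewrite -cp /dot3/=; ring.
have e12 : dot3 (sphere_e1 t p) (sphere_e2 t p) = 0 by rewrite /dot3/=; ring.
have e1n : dot3 (sphere_e1 t p) (sphere_pt t p) = 0.
  transitivity (cos t * sin t * (cos p ^+ 2 + sin p ^+ 2) - cos t * sin t).
    by rewrite /dot3/=; ring.
  by rewrite cp; ring.
have e2n : dot3 (sphere_e2 t p) (sphere_pt t p) = 0 by rewrite /dot3/=; ring.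
have flip (e : R3 R) : exists2 a : R, a ^+ 2 = 1 & 0 <= dot3 v (scale3 a e).
  have [e0|e0] := leP 0 (dot3 v e).
    by exists 1; rewrite ?expr1n//; move: e0; rewrite /dot3/= !mul1r.
  exists (- 1); first by ring.
  move: e0; rewrite -oppr_gt0 => /ltW; congr (0 <= _).
  by rewrite /dot3/=; ring.
have dotZ (a b : R) e e' : dot3 (scale3 a e) (scale3 b e') = a * b * dot3 e e'.
  by rewrite /dot3/=; ring.
have dotZl (a : R) e e' : dot3 (scale3 a e) e' = a * dot3 e e'.
  by rewrite /dot3/=; ring.
have [a a1 a0] := flip (sphere_e1 t p); have [b b1 b0] := flip (sphere_e2 t p).
exists (scale3 a (sphere_e1 t p)), (scale3 b (sphere_e2 t p)).
rewrite !dotZ -!expr2 a1 b1 e11 e22 e12 mulr0 mulr1; split => // e.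
by case=> ->; rewrite dotZl ?e1n ?e2n mulr0.
Qed.

End collision_geometry.

(** The absolute value changes nothing on [0, pi] and makes the weight nonnegative for every [t]. *)
Lemma sphere_intE {R : realType} (g : R3 R -> \bar R) :
  sphere_int g = (\int[lebesgue_measure]_(t in `[0%R, pi%R])
    \int[lebesgue_measure]_(p in `[0%R, (2 * pi)%R])
      (`|sin t|%:E * g (sphere_pt t p)))%E.
Proof.
apply: eq_integral => t; rewrite inE/= in_itv/= => t0pi.
by rewrite ger0_norm// sin_ge0_pi.
Qed.

(** * Integrating the comparison over [w], the sphere and [v] *)

Section collision_integrand.
Context {R : realType}.
Variables (u0 : R3 R) (theta : R) (Phi : R -> R) (f : R3 R -> R) (eps : R).
Hypotheses (theta_gt0 : 0 < theta) (eps_gt0 : 0 < eps)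
  (cPhi : convex_function (`[0, +oo[%classic : set R^o) Phi)
  (dPhi_gt0 : forall x : R, 0 < x -> derivable Phi x 1)
  (f0 : forall v, 0 <= f v) (mf : measurable_fun setT f).
Implicit Types (v w n : R3 R) (B : R -> R -> R).

Let M := maxwellian u0 theta.

Let M0 v : 0 <= M v.
Proof. exact/ltW/maxwellian_gt0. Qed.

Let mM : measurable_fun setT M.
Proof. exact: measurable_maxwellian. Qed.

Definition coll_integrand B v w n : \bar R :=
  ((B (norm3 (sub3 v w)) (coll_xi v w n) * M v * M w)%:E *
   Psi Phi (f v / M v)
     (f (post_velocity v w n) / M (post_velocity v w n)))%E.

Let b_norm_gt0 : 0 < b_norm eps.
Proof. by rewrite b_normE// !mulr_gt0 ?pi_gt0 ?exprn_gt0. Qed.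

Let coll_xi_ge0 v w n : 0 <= coll_xi v w n.
Proof. by rewrite divr_ge0// norm3_ge0. Qed.

Lemma b_eps_ge0 (x : R) : 0 <= x -> 0 <= b_eps eps x.
Proof. by move=> x0; rewrite mulr_ge0// divr_ge0// ltW. Qed.

Lemma measurable_b_eps : measurable_fun setT (b_eps eps).
Proof.
apply: measurable_funM; last exact: measurable_indic.
by apply: measurable_funM; [exact: measurable_id|exact: measurable_cst].
Qed.

Lemma coll_integrand_ge0 B v w n :
  0 <= B (norm3 (sub3 v w)) (coll_xi v w n) -> (0 <= coll_integrand B v w n)%E.
Proof.
move=> B0; apply: mule_ge0; first by rewrite lee_fin mulr_ge0 ?M0// mulr_ge0 ?M0.
by apply: Psi_ge0 => //; rewrite divr_ge0.
Qed.

Lemma measurable_coll_integrand d (T : measurableType d) B (v w n : T -> R3 R) :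
  measurable_fun setT (fun u : R * R => B u.1 u.2) ->
  measurable_fun setT v -> measurable_fun setT w -> measurable_fun setT n ->
  measurable_fun setT (fun x => coll_integrand B (v x) (w x) (n x)).
Proof.
move=> mB mv mw mn.
have mq : measurable_fun setT (fun x => sub3 (v x) (w x)) by exact: measurable_sub3.
have mqn : measurable_fun setT (fun x => dot3 (sub3 (v x) (w x)) (n x)).
  exact: measurable_dot3.
have mN : measurable_fun setT (fun x => norm3 (sub3 (v x) (w x))).
  exact: measurable_norm3.
have mxi : measurable_fun setT (fun x => coll_xi (v x) (w x) (n x)).
  apply: measurable_fun_nneg_div => //; last by move=> x; exact: norm3_ge0.
  exact: measurableT_comp.
have mpv : measurable_fun setT (fun x => post_velocity (v x) (w x) (n x)).
  by apply: measurable_sub3 => //; exact: measurable_scale3.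
apply: emeasurable_funM.
  apply/measurable_EFinP; apply: measurable_funM; last exact: measurableT_comp mM mw.
  apply: measurable_funM; last exact: measurableT_comp mM mv.
  exact: measurableT_comp mB (measurable_fun_pair mN mxi).
apply: measurable_Psi => // [||x|x]; rewrite ?divr_ge0//.
  by apply: measurable_fun_nneg_div => //; exact: measurableT_comp.
apply: measurable_fun_nneg_div => //; first exact: measurableT_comp mf mpv.
exact: measurableT_comp mM mpv.
Qed.

Let mB : measurable_fun setT (fun u : R * R => B_eps eps u.1 u.2).
Proof.
apply: measurable_funM; first exact: measurable_fst.
exact: measurableT_comp measurable_b_eps measurable_snd.
Qed.

Let mBt : measurable_fun setT (fun u : R * R => Btilde_eps eps u.1 u.2).
Proof. exact: measurableT_comp measurable_b_eps measurable_snd. Qed.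

Let CB0 v w n : (0 <= coll_integrand (B_eps eps) v w n)%E.
Proof. by apply: coll_integrand_ge0; rewrite mulr_ge0 ?norm3_ge0// b_eps_ge0. Qed.

Let CBt0 v w n : (0 <= coll_integrand (Btilde_eps eps) v w n)%E.
Proof. by apply: coll_integrand_ge0; rewrite b_eps_ge0. Qed.

Let C : R := 1 + 64 * expR (9 / (2 * theta)) ^+ 2.

Lemma integral_coll_integrand_le v (t p : R) :
  (\int[leb3]_w (`|sin t|%:E * coll_integrand (Btilde_eps eps) v w (sphere_pt t p)) <=
   C%:E * \int[leb3]_w (`|sin t|%:E * coll_integrand (B_eps eps) v w (sphere_pt t p)))%E.
Proof.
have [e1 [e2 [e11 e22 e12 e12n]]] := sphere_frame (sub3 v u0) t p.
have mint B : measurable_fun setT (fun u : R * R => B u.1 u.2) ->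
    measurable_fun setT
      (fun w => `|sin t|%:E * coll_integrand B v w (sphere_pt t p))%E.
  move=> mB'; apply: measurable_funeM; apply: measurable_coll_integrand => //;
  exact: measurable_cst.
apply: (integral_le_norm3 (v := v) (K := expR (9 / (2 * theta))) e11 e22 e12) => //.
- exact: mint.
- exact: mint.
- by move=> w; rewrite mule_ge0.
(* At [v = w] the convention gives xi = 0, where [b_eps] vanishes. *)
- move=> w q0; rewrite /coll_integrand /Btilde_eps coll_xi_eq0// /b_eps.
  by rewrite !mul0r mul0e mule0.
- move=> w; rewrite [RHS]muleCA; congr (_ * _)%E.
  by rewrite /coll_integrand /B_eps /Btilde_eps muleA -EFinM !mulrA.
move=> e ee w z x1 x2 x3; have [en c0] := e12n e ee.
have ee1 : dot3 e e = 1 by case: ee => ->.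
rewrite [leRHS]muleCA; apply: lee_wpmul2l; first by rewrite lee_fin.
(* [Psi] depends on [v] and [v'] only, which the translation keeps. Of the other factors, the kernel
   does not decrease, [M v] is fixed, and [M w] accounts for the constant. *)
rewrite /coll_integrand post_velocity_shift// muleA; apply: lee_wpmul2r.
  by apply: Psi_ge0 => //; rewrite divr_ge0.
have le_pM (b b' m m1 m2 k : R) : 0 <= b -> 0 <= m -> 0 <= m1 -> b <= b' ->
    m1 <= k * m2 -> b * m * m1 <= k * (b' * m * m2).
  move=> b0 m0 m10 bb' mm'; rewrite (_ : k * _ = b' * m * (k * m2)); last by ring.
  by apply: ler_pM => //; [exact: mulr_ge0|exact: ler_wpM2r].
rewrite -EFinM lee_fin; apply: le_pM => //.
- by rewrite mulr_ge0 ?norm3_ge0// b_eps_ge0.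
- exact: (B_eps_shift eps_gt0 ee1).
- exact: (maxwellian_shift theta_gt0 (v := v)).
Qed.

(** The space [T] is that of [w] when [v] is fixed, and that of pairs (v, w) for measurability in
    [v]. *)
Let sphere_measurable d (T : measurableType d) B (v w : T -> R3 R) :
  measurable_fun setT (fun u : R * R => B u.1 u.2) ->
  measurable_fun setT v -> measurable_fun setT w ->
  measurable_fun setT (fun x : (T * measurableTypeR R) * measurableTypeR R =>
    `|sin x.1.2|%:E * coll_integrand B (v x.1.1) (w x.1.1) (sphere_pt x.1.2 x.2))%E.
Proof.
move=> mB' mv mw.
have m1 : measurable_fun setT (fun x : (T * measurableTypeR R) * measurableTypeR R => x.1).
  exact: measurable_fst.
have m11 := measurableT_comp (@measurable_fst _ _ _ _) m1.
have m12 := measurableT_comp (@measurable_snd _ _ _ _) m1.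
apply: emeasurable_funM.
  apply/measurable_EFinP; apply: measurableT_comp => //.
  apply: (measurableT_comp (f := @sin R)) m12.
  by apply: continuous_measurable_fun; exact: continuous_sin.
apply: measurable_coll_integrand => //.
- exact: measurableT_comp mv m11.
- exact: measurableT_comp mw m11.
- by apply: measurable_sphere_pt => //; exact: m12.
Qed.

(** Two uses of [le_tonelli_in] carry the polar angle and then the azimuth outside the integral over
    [w], leaving the estimate for a fixed direction. *)
Lemma sphere_int_coll_integrand_le v :
  (\int[leb3]_w sphere_int (coll_integrand (Btilde_eps eps) v w) <=
   C%:E * \int[leb3]_w sphere_int (coll_integrand (B_eps eps) v w))%E.
Proof.
have C0 : 0 <= C by rewrite addr_ge0// mulr_ge0// sqr_ge0.
pose F B (x : (R3 R * measurableTypeR R) * measurableTypeR R) :=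
  (`|sin x.1.2|%:E * coll_integrand B v x.1.1 (sphere_pt x.1.2 x.2))%E.
have mF B : measurable_fun setT (fun u : R * R => B u.1 u.2) ->
    measurable_fun setT (F B).
  move=> mB'; apply: (sphere_measurable mB' (v := fun=> v) (w := id)).
    exact: measurable_cst.
  exact: measurable_id.
have F0 B : (forall v w n, 0 <= coll_integrand B v w n)%E -> forall x, (0 <= F B x)%E.
  by move=> B0 x; rewrite mule_ge0.
have FE B : (\int[leb3]_w sphere_int (coll_integrand B v w) =
    \int[leb3]_w \int[lebesgue_measure]_(t in `[0%R, pi%R])
      \int[lebesgue_measure]_(p in `[0%R, (2 * pi)%R]) F B ((w, t), p))%E.
  by apply: eq_integral => w _; exact: sphere_intE.
rewrite [leLHS]FE [X in (_ <= _ * X)%E]FE.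
pose I B (x : R3 R * measurableTypeR R) :=
  (\int[lebesgue_measure]_(p in `[0%R, (2 * pi)%R]) F B (x, p))%E.
apply: (@le_tonelli_in _ _ _ _ R leb3 lebesgue_measure _
  (I (Btilde_eps eps)) (I (B_eps eps)) C) => //.
- by apply: measurable_integral_in => // [|x y _]; [exact: mF|exact: F0].
- by apply: measurable_integral_in => // [|x y _]; [exact: mF|exact: F0].
- by move=> w t _; apply: integral_ge0 => p _; exact: F0.
- by move=> w t _; apply: integral_ge0 => p _; exact: F0.
move=> t _.
have mFt B : measurable_fun setT (fun u : R * R => B u.1 u.2) ->
    measurable_fun setT (fun x : R3 R * measurableTypeR R => F B ((x.1, t), x.2)).
  move=> mB'; apply: (measurableT_comp (mF _ mB')).
  by apply: measurable_fun_pair => //; exact: measurable_fun_pair.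
apply: (@le_tonelli_in _ _ _ _ R leb3 lebesgue_measure _
  (fun x => F (Btilde_eps eps) ((x.1, t), x.2))
  (fun x => F (B_eps eps) ((x.1, t), x.2)) C) => //.
- exact: mFt.
- exact: mFt.
- by move=> w p _; exact: F0.
- by move=> w p _; exact: F0.
by move=> p _; exact: integral_coll_integrand_le.
Qed.

Lemma measurable_sphere_int_coll_integrand B :
  measurable_fun setT (fun u : R * R => B u.1 u.2) ->
  (forall v w n, 0 <= coll_integrand B v w n)%E ->
  measurable_fun setT
    (fun v => \int[leb3]_w sphere_int (coll_integrand B v w))%E.
Proof.
move=> mB' B0.
have mF := @sphere_measurable _ (R3 R * R3 R)%type B fst snd mB'
  measurable_fst measurable_snd.
have F0 v w t p : (0 <= `|sin t|%:E * coll_integrand B v w (sphere_pt t p))%E.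
  exact: mule_ge0.
have mFp := @measurable_integral_in _ _ _ _ R lebesgue_measure
  `[0%R, (2 * pi)%R]%classic _ (measurable_itv _) mF (fun x p _ => F0 _ _ _ p).
have Fp0 v w t : (0 <= \int[lebesgue_measure]_(p in `[0%R, (2 * pi)%R])
    (`|sin t|%:E * coll_integrand B v w (sphere_pt t p)))%E.
  by apply: integral_ge0 => p _; exact: F0.
have mFtp := @measurable_integral_in _ _ _ _ R lebesgue_measure
  `[0%R, pi%R]%classic _ (measurable_itv _) mFp (fun x t _ => Fp0 _ _ t).
have := @measurable_fun_fubini_tonelli_F _ _ _ _ R leb3 _ mFtp.
rewrite [X in _ -> measurable_fun _ X](_ : _ = fun v => \int[leb3]_w
    \int[lebesgue_measure]_(t in `[0%R, pi%R])
      \int[lebesgue_measure]_(p in `[0%R, (2 * pi)%R])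
        (`|sin t|%:E * coll_integrand B v w (sphere_pt t p)))%E; last first.
  by apply/funext => v; apply: eq_integral => w _; exact: sphere_intE.
by apply=> x; apply: integral_ge0 => t _; exact: Fp0.
Qed.

Lemma entropy_dissipation_le :
  (entropy_dissipation u0 theta (Btilde_eps eps) Phi f <=
   C%:E * entropy_dissipation u0 theta (B_eps eps) Phi f)%E.
Proof.
have I0 B : (forall v w n, 0 <= coll_integrand B v w n)%E -> forall v,
    (0 <= \int[leb3]_w sphere_int (coll_integrand B v w))%E.
  move=> B0 v; apply: integral_ge0 => w _; rewrite sphere_intE.
  by apply: integral_ge0 => t _; apply: integral_ge0 => p _; exact: mule_ge0.
rewrite /entropy_dissipation muleCA; apply: lee_wpmul2l => //.
rewrite -ge0_integralZl//; last 3 first.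
- exact: measurable_sphere_int_coll_integrand.
- by move=> v _; exact: I0.
- by rewrite lee_fin addr_ge0// mulr_ge0// sqr_ge0.
apply: ge0_le_integral => //.
- by move=> v _; exact: I0.
- exact: measurable_sphere_int_coll_integrand.
- by apply: measurable_funeM; exact: measurable_sphere_int_coll_integrand.
- by move=> v _; exact: sphere_int_coll_integrand_le.
Qed.

End collision_integrand.

Theorem proposition5p2 (R : realType) (u0 : R3 R) (theta : R)
    (theta_gt0 : 0 < theta) :
  exists2 C : R, 0 < C &
    forall (eps : R), 0 < eps -> eps <= 1 ->
    forall (Phi : R -> R),
      (forall x : R, 0 <= x -> 0 <= Phi x) ->
      convex_function (`[0, +oo[%classic : set R^o) Phi ->
      (forall x : R, 0 < x -> derivable Phi x 1) ->
    forall (f : R3 R -> R), is_prob_distribution f ->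
    (entropy_dissipation u0 theta (B_eps eps) Phi f >=
     C%:E * entropy_dissipation u0 theta (Btilde_eps eps) Phi f)%E.
Proof.
pose C : R := 1 + 64 * expR (9 / (2 * theta)) ^+ 2.
have C0 : 0 < C by rewrite ltr_wpDr// mulr_ge0// sqr_ge0.
(* [entropy_dissipation_le] bounds the dissipation for [Btilde_eps] by [C] times the one for
   [B_eps], hence the inverse. [C] involves only [theta], so it is uniform in [eps], [Phi] and
   [f]. *)
exists C^-1; first by rewrite invr_gt0.
move=> eps eps0 _ Phi _ cPhi dPhi f [f0 /measurable_int /measurable_EFinP mf _].
rewrite lee_pdivrMl//.
exact: entropy_dissipation_le.
Qed.
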